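(* Let $p$ be a prime and let $G$ be a finite $p$-group with $|G|=p^5$ and nilpotency class $cl(G)=3$. Then $\mathrm{Aut}_z(G)=Z(\mathrm{Inn}(G))$ if and only if $d(G)=2$ and $|Z(G)|=p$.
   Context: For a group $G$: $Z(G)$ is the center of $G$; $\mathrm{Inn}(G)$ is the group of inner automorphisms of $G$ and $Z(\mathrm{Inn}(G))$ is its center; $d(G)$ (the rank of $G$) is the minimal number of generators of $G$; $cl(G)$ is the nilpotency class of $G$. An automorphism $\alpha$ of $G$ is central if $x^{-1}\alpha(x)\in Z(G)$ for all $x\in G$ (equivalently, $\alpha$ commutes with every inner automorphism of $G$). $\mathrm{Aut}_z(G)$ denotes the subgroup of $\mathrm{Aut}(G)$ consisting of all central automorphisms. *)

(* Defs.v *)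
From mathcomp Require Import all_boot all_fingroup all_solvable.

Set Implicit Arguments.
Unset Strict Implicit.
Unset Printing Implicit Defensive.

Import GroupScope.

Section Defs.

Variables (gT : finGroupType) (G : {group gT}).

(* [conj_aut G x] is conjugation by x on G, extended by the identity outside
   G, as for every element of [Aut G]. *)
Definition Inn : {set {perm gT}} := conj_aut G @* G.

Canonical Inn_group := [group of Inn].

Definition Autz : {set {perm gT}} :=
  [set a in Aut G | [forall x in G, x^-1 * a x \in 'Z(G)]].

Lemma AutzP (a : {perm gT}) :
  reflect (a \in Aut G /\ {in G, forall x, x^-1 * a x \in 'Z(G)})
          (a \in Autz).
Proof.
apply: (iffP idP) => [|[Aa Ha]].
  by rewrite inE => /andP[Aa /forall_inP].
by rewrite inE Aa; apply/forall_inP.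
Qed.

Lemma Autz_group_set : group_set Autz.
Proof.
apply/group_setP; split=> [|a b /AutzP[Aa Za] /AutzP[Ab Zb]]; apply/AutzP.
  by split=> [|x Gx]; rewrite ?group1 // perm1 mulVg group1.
split=> [|x Gx]; first exact: groupM.
have Gax: a x \in G by rewrite Aut_closed.
by rewrite permM -(mulKVg (a x) (b (a x))) mulgA groupM ?Za ?Zb.
Qed.

Canonical Autz_group := Group Autz_group_set.

End Defs.

(* Main.v *)
Require Import Defs.
From mathcomp Require Import all_boot all_fingroup all_solvable.

Set Implicit Arguments.
Unset Strict Implicit.
Unset Printing Implicit Defensive.

Import GroupScope.

(** If M is a maximal subgroup of G and w in M is central of order p, then
    x |-> x f(x), with f : G -> G / M ~ <w>, is a central automorphism whose
    fixed points form M.  When all central automorphisms are inner, this one is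
    conjugation by some y in Z_2(G), so every maximal subgroup is a centralizer
    C_G(y) with y in Z_2(G).  Two distinct ones, C_G(y1) and C_G(y2), give a
    chain Z(G) < Z(G)<y1> < Z(G)<y1, y2> in Z_2(G); since |Z_2(G)| <= p^3, this
    forces |Z(G)| = p and Z_2(G) = Z(G)<y1, y2>.  Hence every maximal subgroup
    contains C_G(y1) :&: C_G(y2), so |G : Phi(G)| <= p^2.
    Conversely, a central automorphism is determined by x^-1 a(x) in Z(G) for x
    in a generating set, so |Autz G| <= |Z(G)|^2 = p^2, while Z(Inn G), always
    contained in Autz G, is isomorphic to the center of G / Z(G).  That center
    has order at least p^2: were its order p, it would contain Phi(G / Z(G)),
    which has index at most p^2 in a group of order p^4. *)

(** * Construction and counting of central automorphisms *)

Section CentralAutomorphisms.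

Variable gT : finGroupType.
Implicit Types G M : {group gT}.

(** Central values make the map multiplicative. As [f] kills its own image, [x * f x = 1] puts
    [x = (f x)^-1] in the kernel, whence [x = 1]; injectivity and finiteness give an
    automorphism. *)
Lemma central_aut_of_morphism G (f : {morphism G >-> gT}) :
    f @* G \subset 'Z(G) -> f @* G \subset 'ker f ->
  exists2 a, a \in Autz G & {in G, forall x, a x = x * f x}.
Proof.
move=> sfZ sfK.
have Zf x : x \in G -> f x \in 'Z(G).
  by move=> Gx; rewrite (subsetP sfZ) ?mem_morphim.
have Gf x : x \in G -> f x \in G by move=> /Zf/centerP[].
have gM : {in G &, {morph (fun x => x * f x) : x y / x * y}}.
  move=> x y Gx Gy /=; rewrite morphM // !mulgA; congr (_ * _).
  by rewrite -!mulgA; congr (_ * _); have [_ ->] := centerP _ _ (Zf x Gx).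
pose g := Morphism gM.
have injg : 'injm g.
  apply/subsetP=> x /morphpreP[Gx /set1P /= gx1].
  have Kx : x \in 'ker f.
    have -> : x = (f x)^-1 by apply/eqP; rewrite eq_mulgV1 invgK gx1.
    by rewrite groupV (subsetP sfK) ?mem_morphim.
  by rewrite inE -{1}gx1 (mker Kx) mulg1.
have imgG : g @* G = G.
  apply/eqP; rewrite eqEcard card_injm // leqnn andbT.
  by apply/subsetP=> _ /morphimP[x _ Gx ->] /=; rewrite groupM ?Gf.
exists (aut injg imgG) => [|x Gx]; last by rewrite autE.
apply/AutzP; split; first exact: Aut_aut.
by move=> x Gx; rewrite autE //= mulKg Zf.
Qed.

Lemma maximal_central_aut (p : nat) G M :
    p.-group G -> maximal M G -> M :!=: 1 ->
  exists2 a, a \in Autz G & {in G, forall x, (a x == x) = (x \in M)}.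
Proof.
move=> pG maxM ntM.
have nsMG := p_maximal_normal pG maxM; have [sMG nMG] := andP nsMG.
have [p_pr _ _] := pgroup_pdiv (pgroupS sMG pG) ntM.
(* A nontrivial normal subgroup of a nilpotent group meets the center, so [w] can be chosen inside
   [M], the kernel of the map [f] below; hence [f] kills its image. *)
have ntMZ := meet_center_nil (pgroup_nil pG) nsMG ntM.
have pMZ : p.-group (M :&: 'Z(G)) := pgroupS (subsetIl _ _) (pgroupS sMG pG).
have [_ p_dv _] := pgroup_pdiv pMZ ntMZ.
have [w /setIP[Mw Zw] ow] := Cauchy p_pr p_dv.
have oGM : #|G / M| = p by rewrite card_quotient // (p_maximal_index pG).
have /cyclicP[xq defGM] : cyclic (G / M) by rewrite prime_cyclic ?oGM.
have oxq : #[xq] = p by rewrite orderE -defGM.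
have dv : #[w] %| #[xq] by rewrite ow oxq.
pose h := eltm_morphism dv \o coset M.
have sGh : G \subset coset M @*^-1 <[xq]>.
  by rewrite -defGM -sub_quotient_pre.
pose f := [morphism of restrm sGh h].
have kerf : 'ker f = M.
  have ker1 : 'ker (eltm_morphism dv) = 1.
    by apply/trivgP; rewrite injm_eltm ow oxq.
  rewrite ker_restrm ker_comp ker1 -kerE ker_coset; exact/setIidPr.
have imf : f @* G \subset <[w]>.
  rewrite /= morphim_restrm setIid morphim_comp /= -[coset M @* G]/(G / M).
  by rewrite defGM im_eltm.
have [||a Za aE] := @central_aut_of_morphism G f.
- by rewrite (subset_trans imf) // cycle_subG.
- by rewrite kerf (subset_trans imf) // cycle_subG.
exists a => // x Gx; rewrite aE // -[in RHS]kerf.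
apply/eqP/idP=> [xfx | /mker->]; last by rewrite mulg1.
by apply/kerP=> //; apply: (mulgI x); rewrite mulg1.
Qed.

(** Conjugations by [x] and [y] commute, so [x^-1 * x ^ y = [~ x, y]] lies in the kernel of
    [conj_aut G], which is the center. *)
Lemma center_Inn_sub_Autz G : 'Z(Inn G) \subset Autz G.
Proof.
apply/subsetP=> a /setIP[/morphimP[y Ny Gy ->{a}] /centP cy].
apply/AutzP; split; first exact: Aut_aut.
move=> x Gx; rewrite conj_autE // -/([~ x, y]).
rewrite /center -ker_conj_aut inE groupR //=.
have Nx := subsetP (normG G) x Gx.
apply/kerP; first exact: groupR.
rewrite morphR //=; apply/eqP/commgP/commute_sym/cy.
exact: mem_morphim.
Qed.

Lemma conj_aut_Autz_ucn2 G y :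
  y \in G -> conj_aut G y \in Autz G -> y \in 'Z_2(G).
Proof.
move=> Gy /AutzP[_ Zy].
rewrite ucnSnR ucn1 inE Gy /= gen_subG.
apply/subsetP=> _ /imset2P[_ x /set1P-> Gx ->].
by rewrite -invg_comm groupV commgEl -(conj_autE Gy Gx) Zy.
Qed.

Lemma card_center_Inn G : #|'Z(Inn G)| = #|'Z(G / 'Z(G))|.
Proof.
have /isog_center/card_isog-> // : Inn G \isog G / 'Z(G).
have := first_isog_loc (conj_aut_morphism G) (normG G).
by rewrite isog_sym /= ker_conj_aut.
Qed.

Lemma card_Autz_leq G : #|Autz G| <= #|'Z(G)| ^ 'm(G).
Proof.
have [B defG <-] := grank_witness G.
have sBG : B \subset G by rewrite -defG subset_gen.
(* The default 1 off [B] gives [f a] support in [B], so that there are at most [#|'Z(G)| ^ #|B|]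
   such functions. *)
pose f (a : {perm gT}) := [ffun x => if x \in B then x^-1 * a x else 1].
have injf : {in Autz G &, injective f}.
  move=> a b /AutzP[Aa _] /AutzP[Ab _] /ffunP eq_fab.
  (* The points where [a] and [b] agree form a subgroup containing the generators [B]. *)
  have gE : group_set [set x in G | a x == b x].
    apply/group_setP; split=> [|x y].
      by rewrite inE group1 -(autmE Aa) -(autmE Ab) !morph1 /=.
    rewrite !inE => /andP[Gx /eqP eqx] /andP[Gy /eqP eqy].
    by rewrite groupM //= -(autmE Aa) -(autmE Ab) !morphM //= !autmE eqx eqy.
  have sGE : G \subset Group gE.
    rewrite -{1}defG gen_subG; apply/subsetP=> x Bx.
    rewrite inE (subsetP sBG) //=; apply/eqP/(mulgI x^-1).
    by have := eq_fab x; rewrite !ffunE Bx.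
  by apply: (eq_Aut Aa Ab) => x /(subsetP sGE); rewrite inE => /andP[_ /eqP].
rewrite -(card_in_imset injf) -(card_pffun_on 1).
apply/subset_leq_card/subsetP=> _ /imsetP[a /AutzP[_ Za] ->].
apply/pffun_onP; split=> [|_ /imageP[x /= Bx ->]].
  by apply/subsetP=> x; apply: contraNT => /[!ffunE]/negPf->.
by rewrite ffunE Bx Za ?(subsetP sBG).
Qed.

End CentralAutomorphisms.

(** * Generators, centers and maximal subgroups of p-groups *)

Section PGroups.

Variables (gT : finGroupType) (p : nat).
Implicit Types G M : {group gT}.

(* The Burnside basis theorem. *)
Lemma grank_Phi G : p.-group G -> 'm(G) = logn p #|G / 'Phi(G)|.
Proof.
move=> pG; have abGq := Phi_quotient_abelem pG.
rewrite -(rank_abelem abGq) -grank_abelian ?(abelem_abelian abGq) //.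
apply/eqP; rewrite eqn_leq quotient_grank ?gFnorm // andbT.
have nPG : G \subset 'N('Phi(G)) := gFnorm _ _.
have [Bq defGq <-] := grank_witness (G / 'Phi(G)).
(* Lifts of a smallest generating set of the quotient generate [G] modulo ['Phi(G)], hence generate
   [G]. *)
pose B := (repr \o val : coset_of _ -> gT) @: Bq.
have sBN : B \subset 'N('Phi(G)).
  by apply/subsetP=> _ /imsetP[bq _ ->]; apply: repr_coset_norm.
have defBq : B / 'Phi(G) = Bq.
  apply/setP=> bq; apply/imsetP/idP=> [[_ /setIP[_ /imsetP[c Bc ->]] ->] | Bbq].
    by rewrite /= coset_reprK.
  exists (repr bq); rewrite /= ?coset_reprK // inE repr_coset_norm.
  by apply/imsetP; exists bq.
have genB : <<B>> = G.
  apply: Phi_nongen; rewrite -joing_idr norm_joinEr ?gen_subG //.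
  rewrite -quotientK ?gen_subG // quotient_gen // defBq defGq.
  by rewrite quotientGK ?Phi_normal.
by rewrite -[X in 'm(X)]genB (leq_trans (grank_min B)) // leq_imset_card.
Qed.

Lemma logn_center_index_gt1 G :
  prime p -> p.-group G -> ~~ abelian G -> 1 < logn p #|G / 'Z(G)|.
Proof.
move=> p_pr pG; apply: contraR; rewrite -leqNgt => cycGs.
apply: cyclic_center_factor_abelian; rewrite (dvdn_prime_cyclic p_pr) //.
by rewrite (card_pgroup (quotient_pgroup _ pG)) (dvdn_exp2l _ cycGs).
Qed.

(** Commutators are central, so [[~ x ^+ p, y] = [~ x, y] ^+ p], which is 1 in a center of order
    [p]. Thus p-th powers are central too, and with the commutators they generate ['Phi(G)]. *)
Lemma Phi_sub_prime_center G :
    p.-group G -> nil_class G <= 2 -> prime #|'Z(G)| ->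
  'Phi(G) \subset 'Z(G).
Proof.
move=> pG; rewrite nil_class2 => sG'Z prZ.
have oZ : #|'Z(G)| = p.
  by have /pgroupP/(_ _ prZ (dvdnn _))/eqnP := pgroupS (center_sub G) pG.
rewrite (Phi_joing pG) join_subG sG'Z (MhoE 1 pG) expn1 gen_subG.
apply/subsetP=> _ /imsetP[x Gx ->]; apply/centerP; split=> [|y Gy].
  exact: groupX.
have Zxy : [~ x, y] \in 'Z(G) by rewrite (subsetP sG'Z) ?mem_commg.
apply/commgP; rewrite commXg; last first.
  by have [_ cxy] := centerP _ _ Zxy; apply/commute_sym/cxy.
by rewrite -oZ -order_dvdn order_dvdG.
Qed.

(** A center of order [p] would contain ['Phi(G)], of index at most [p ^ 2], so [G] would have order
    at most [p ^ 3]. *)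
Lemma logn_center_gt1_grank2 G :
    prime p -> p.-group G -> nil_class G = 2 -> 'm(G) <= 2 ->
    3 < logn p #|G| ->
  1 < logn p #|'Z(G)|.
Proof.
move=> p_pr pG clG mG oG.
have ntG : G :!=: 1 by rewrite -nil_class0 clG.
have ntZ : 'Z(G) != 1 by rewrite (center_nil_eq1 (pgroup_nil pG)).
have [_ _ [m oZ]] := pgroup_pdiv (pgroupS (center_sub G) pG) ntZ.
rewrite oZ pfactorK //; case: m oZ => // oZ.
have sPZ : 'Phi(G) \subset 'Z(G).
  by apply: Phi_sub_prime_center; rewrite ?clG ?oZ ?expn1.
have := mG; rewrite (grank_Phi pG) card_quotient ?gFnorm // leqNgt => /negP[].
rewrite -divgS ?Phi_sub // logn_div ?cardSg ?Phi_sub // ltn_subRL.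
apply: leq_trans oG; rewrite addn2 !ltnS.
by rewrite -(@pfactorK p 1) // -oZ dvdn_leq_log ?cardSg.
Qed.

Lemma card_ucn2 G : #|'Z_2(G)| = (#|'Z(G)| * #|'Z(G / 'Z(G))|)%N.
Proof.
have := ucn_central 1 G; rewrite ucn1 => <-.
have := ucn_normalS 1 G; rewrite ucn1 => /andP[sZ nZ].
by rewrite card_quotient // Lagrange.
Qed.

Lemma p_maximal_nt G M :
  p.-group G -> ~~ cyclic G -> maximal M G -> M :!=: 1.
Proof.
move=> pG ncG maxM; apply: contraNneq ncG => M1.
have [-> | ntG] := eqsVneq G 1; first exact: cyclic1.
have [p_pr _ _] := pgroup_pdiv pG ntG.
by rewrite prime_cyclic // -indexg1 -[X in #|G : X|]M1 (p_maximal_index pG).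
Qed.

Lemma p_maximal_eq_cent1 G M :
    p.-group G -> ~~ cyclic G -> Autz G \subset Inn G -> maximal M G ->
  exists2 y, y \in 'Z_2(G) & 'C_G[y] = M.
Proof.
move=> pG ncG sAI maxM; have ntM := p_maximal_nt pG ncG maxM.
have sMG := normal_sub (p_maximal_normal pG maxM).
have [a Za aE] := maximal_central_aut pG maxM ntM.
have /morphimP[y Ny Gy defa] := subsetP sAI a Za.
exists y; first by rewrite conj_aut_Autz_ucn2 // -[conj_aut G y]defa.
apply/setP=> x; rewrite inE; apply/andP/idP=> [[Gx cxy] | Mx].
  rewrite -aE // defa /= conj_autE //; apply/eqP/conjg_fixP/commgP.
  exact/cent1P.
have Gx := subsetP sMG x Mx; split=> //.
apply/cent1P/commgP/conjg_fixP.
by apply/eqP; move: Mx; rewrite -aE // defa /= conj_autE.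
Qed.

(** If [M1] lay in every maximal subgroup it would equal ['Phi(G)]; then [G / 'Phi(G)] has order
    [p], and [G] is cyclic. *)
Lemma p_maximal_pair G :
    p.-group G -> ~~ cyclic G ->
  exists M1 M2 : {group gT},
    [/\ maximal M1 G, maximal M2 G & ~~ (M1 \subset M2)].
Proof.
move=> pG ncG.
have ntG : G :!=: 1 by apply: contraNneq ncG => ->; apply: cyclic1.
have [/eqP|[M1 maxM1 _]] := maximal_exists (sub1G G).
  by rewrite eq_sym (negPf ntG).
case: (boolP [exists M2 : {group gT}, maximal M2 G && ~~ (M1 \subset M2)]).
  by case/existsP=> M2 /andP[maxM2 nsM]; exists M1, M2.
rewrite negb_exists => /forallP M1min; case/negP: ncG.
have [p_pr _ _] := pgroup_pdiv pG ntG.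
have defPhi : 'Phi(G) = M1.
  apply/eqP; rewrite eqEsubset Phi_sub_max //; apply/bigcapsP=> M.
  case/predU1P=> [-> | maxM]; first exact: proper_sub (maxgroupp maxM1).
  by have := M1min M; rewrite maxM /= negbK.
apply: Phi_quotient_cyclic; rewrite prime_cyclic // card_quotient ?gFnorm //.
by rewrite /= defPhi (p_maximal_index pG).
Qed.

Lemma grank_gt1 G : p.-group G -> ~~ cyclic G -> 1 < 'm(G).
Proof.
move=> pG; apply: contraR; rewrite -leqNgt (grank_Phi pG) => mG.
apply: Phi_quotient_cyclic; have pGq := quotient_pgroup 'Phi(G) pG.
have [-> | ntGq] := eqsVneq (G / 'Phi(G)) 1; first exact: cyclic1.
have [p_pr _ _] := pgroup_pdiv pGq ntGq.
by rewrite (dvdn_prime_cyclic p_pr) // (card_pgroup pGq) (dvdn_exp2l _ mG).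
Qed.

Lemma Autz_sub_Inn_center_grank G :
    p.-group G -> ~~ cyclic G -> logn p #|'Z_2(G)| <= 3 ->
  Autz G \subset Inn G -> 'm(G) = 2 /\ #|'Z(G)| = p.
Proof.
move=> pG ncG oZ2 sAI; have ntG : G :!=: 1.
  by apply: contraNneq ncG => ->; apply: cyclic1.
have [p_pr _ _] := pgroup_pdiv pG ntG.
have [M1 [M2 [max1 max2 ns12]]] := p_maximal_pair pG ncG.
have [y1 Zy1 C1] := p_maximal_eq_cent1 pG ncG sAI max1.
have [y2 Zy2 C2] := p_maximal_eq_cent1 pG ncG sAI max2.
have pZ2 : p.-group 'Z_2(G) := pgroupS (ucn_sub _ _) pG.
pose A := ('Z(G) <*> <[y1]>)%G; pose B := (A <*> <[y2]>)%G.
have sZZ2 : 'Z(G) \subset 'Z_2(G) by rewrite -ucn1 ucn_subS.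
have sBZ2 : B \subset 'Z_2(G) by rewrite !join_subG sZZ2 !cycle_subG Zy1.
have sAB : A \subset B := joing_subl _ _.
have pA : p.-group A := pgroupS (subset_trans sAB sBZ2) pZ2.
have cAM1 : M1 \subset 'C(A).
  rewrite centsC join_subG cycle_subG -sub_cent1 -{2}C1 subsetIr andbT.
  by rewrite subIset // centS ?orbT // -C1 subsetIl.
(* A central [y1] would give [M1 = 'C_G[y1] = G]. *)
have prZA : 'Z(G) \proper A.
  rewrite properE joing_subl join_subG subxx cycle_subG /=.
  apply: contra ns12 => /setIP[_ cy1].
  case/negP: (proper_subn (maxgroupp max1)).
  by rewrite -C1 subsetI subxx sub_cent1.
(* [M1] centralizes [A], so [y2] in [A] would give [M1] inside ['C_G[y2] = M2]. *)
have prAB : A \proper B.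
  rewrite properE sAB join_subG subxx cycle_subG /=.
  apply: contra ns12 => Ay2; rewrite -C2 subsetI -{1}C1 subsetIl sub_cent1.
  by rewrite (subsetP _ _ Ay2) // centsC.
have ltZA := properG_ltn_log pA prZA.
have ltAB := properG_ltn_log (pgroupS sBZ2 pZ2) prAB.
have pZ : p.-group 'Z(G) := pgroupS (center_sub G) pG.
have ntZ : 'Z(G) != 1 by rewrite (center_nil_eq1 (pgroup_nil pG)).
have [_ _ [m oZ]] := pgroup_pdiv pZ ntZ.
have lB : logn p #|B| <= 3.
  by rewrite (leq_trans _ oZ2) // dvdn_leq_log ?cardSg.
(* The center has order [p ^ m.+1], and two strict inclusions lead up to [B], of order at most
   [p ^ 3]. *)
have m0 : m = 0%N.
  rewrite oZ pfactorK // in ltZA.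
  by have := leq_trans ltZA (leq_trans ltAB lB); case: (m).
rewrite oZ m0 expn1; split=> //.
apply/eqP; rewrite eqn_leq grank_gt1 // andbT (grank_Phi pG).
have defB : B :=: 'Z_2(G).
  apply/eqP; rewrite eqEcard sBZ2 (card_pgroup pZ2).
  rewrite (card_pgroup (pgroupS sBZ2 pZ2)) leq_exp2l ?prime_gt1 //.
  rewrite (leq_trans oZ2) // (leq_trans _ ltAB) // ltnS (leq_trans _ ltZA) //.
  by rewrite oZ m0 pfactorK.
have sM12 : M1 :&: M2 \subset 'Phi(G).
  apply/bigcapsP=> M /predU1P[-> | maxM].
    by rewrite subIset // -C1 subsetIl.
  have [y Zy <-] := p_maximal_eq_cent1 pG ncG sAI maxM.
  have sM1G : M1 \subset G by rewrite -C1 subsetIl.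
  rewrite subsetI subIset ?sM1G //= sub_cent1.
  rewrite -defB in Zy; apply: subsetP y Zy; rewrite join_subG cycle_subG.
  rewrite (subset_trans _ (centS (subsetIl _ _))) //= 1?centsC //.
  by rewrite -sub_cent1 subIset // -C2 subsetIr orbT.
have [sM1G sM2G] : M1 \subset G /\ M2 \subset G.
  by rewrite -{1}C1 -C2 !subsetIl.
(* Here [M1] need not lie in [M2]: the index counts the cosets of [M1] in the set [M1 * M2], and
   equals the index of the intersection in [M2]. *)
have iM2 : #|M2 : M1| <= p.
  rewrite -(p_maximal_index pG max1) -(leq_pmul2l (cardG_gt0 M1)).
  by rewrite LagrangeMl Lagrange // subset_leq_card // mul_subG.
rewrite -(leq_exp2l _ _ (prime_gt1 p_pr)) -card_pgroup ?quotient_pgroup //.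
rewrite card_quotient ?gFnorm //.
apply: leq_trans (dvdn_leq (indexg_gt0 _ _) (indexgS G sM12)) _.
rewrite /= setIC -(Lagrange_index sM2G (subsetIl _ _)) indexgI.
by rewrite (p_maximal_index pG max2) leq_mul.
Qed.

End PGroups.

Theorem theorem3p2 (gT : finGroupType) (G : {group gT}) (p : nat)
    (p_pr : prime p) (pG : p.-group G) (oG : #|G| = (p ^ 5)%N)
    (clG : nil_class G = 3) :
  Autz G = 'Z(Inn G) <-> 'm(G) = 2 /\ #|'Z(G)| = p.
Proof.
have clGZ : nil_class (G / 'Z(G)) = 2.
  by rewrite nil_class_quotient_center ?(pgroup_nil pG) ?clG.
have pGZ : p.-group (G / 'Z(G)) := quotient_pgroup _ pG.
have nZG : G \subset 'N('Z(G)) := gFnorm _ _.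
have logGZ : (logn p #|'Z(G)| + logn p #|G / 'Z(G)| = 5)%N.
  rewrite -lognM ?cardG_gt0 // card_quotient // Lagrange ?center_sub //.
  by rewrite oG pfactorK.
split=> [eqAZ | [mG oZ]].
  apply: (Autz_sub_Inn_center_grank pG); last by rewrite eqAZ center_sub.
    by apply/negP=> /cyclic_abelian; rewrite -nil_class1 clG.
  have ncGZ : ~~ abelian (G / 'Z(G)) by rewrite -nil_class1 clGZ.
  (* The center of [G / 'Z(G)] has index at least [p ^ 2] there, so ['Z_2(G)] has order at most
     [p ^ (5 - 2)]. *)
  have := logn_center_index_gt1 p_pr pGZ ncGZ.
  rewrite card_quotient ?gFnorm // -divgS ?center_sub //.
  rewrite logn_div ?cardSg ?center_sub // ltn_subRL => lt1.
  rewrite card_ucn2 lognM ?cardG_gt0 // -(leq_add2r 2) -addnA.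
  by rewrite (leq_trans _ (eq_leq logGZ)) // leq_add2l addn2 -addn1.
apply/eqP; rewrite eq_sym eqEcard center_Inn_sub_Autz /=.
apply: leq_trans (card_Autz_leq G) _.
have pZI : p.-group 'Z(G / 'Z(G)) := pgroupS (center_sub _) pGZ.
rewrite card_center_Inn mG oZ (card_pgroup pZI) leq_exp2l ?(prime_gt1 p_pr) //.
(* Applied to [G / 'Z(G)], which has class 2, order [p ^ 4] and at most two generators. *)
apply: logn_center_gt1_grank2 => //.
  by rewrite -mG quotient_grank.
by move: logGZ; rewrite oZ logn_prime // eqxx add1n => -[->].
Qed.
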